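(* Let $A$ be a (possibly infinite dimensional) tabular algebra over $\mathcal{A}=\mathbb{Z}[v,v^{-1}]$ with trace $\tau$ and table datum $(\Lambda,\Gamma,B,M,C,* )$. Then the map $(x,y)\mapsto\tau(xy^* )$ defines a symmetric, nondegenerate bilinear form $(\ ,\ )$ on $A$ with the following properties. (i) For all $x,y,z\in A$, $(x,yz)=(xz^*,y)$. (ii) The tabular basis is almost orthonormal with respect to this bilinear form: whenever $X,X'\in\mathrm{Im}(C)$, we have $(X,X')\equiv 1\bmod v^{-1}\mathcal{A}^-$ if $X=X'$, and $(X,X')\equiv 0\bmod v^{-1}\mathcal{A}^-$ otherwise, where $\mathcal{A}^-=\mathbb{Z}[v^{-1}]$.
   Context: **Normalized table algebras.** A normalized table algebra over $\mathbb{Z}$ is a pair $(\Gamma,B)$, where $\Gamma$ is an associative unital $\mathbb{Z}$-algebra (possibly noncommutative or of infinite rank) and $B$ is a $\mathbb{Z}$-basis of $\Gamma$ with $1\in B$, such that: (T1) the structure constants of $\Gamma$ with respect to $B$ are nonnegative integers; (T2) there is a linear algebra anti-automorphism $\bar{\ }$ of $\Gamma$ with square the identity and $\overline{B}=B$; (T3) writing $\kappa(b,a)$ for the coefficient of $b\in B$ in $a\in\Gamma$, one has $\kappa(b'',bb')=\kappa(b,b''\,\overline{b'})$ for all $b,b',b''\in B$. Write $\mathrm{supp}(a)=\{b\in B:\kappa(b,a)\neq0\}$. **Tabular algebras.** Let $\mathcal{A}=\mathbb{Z}[v,v^{-1}]$. A tabular algebra is an $\mathcal{A}$-algebra $A$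 with a table datum $(\Lambda,\Gamma,B,M,C,* )$ where: (A1) $\Lambda$ is a finite poset. For each $\lambda\in\Lambda$, $(\Gamma(\lambda),B(\lambda))$ is a normalized table algebra over $\mathbb{Z}$ and $M(\lambda)$ is a finite set. The map $C:\coprod_{\lambda\in\Lambda}(M(\lambda)\times B(\lambda)\times M(\lambda))\to A$ is injective with image an $\mathcal{A}$-basis of $A$ (the tabular basis). The image $\mathrm{Im}(C)$ contains a set of mutually orthogonal idempotents $\{1_\varepsilon:\varepsilon\in\mathcal{E}\}$ such that $A=\sum_{\varepsilon,\varepsilon'}1_\varepsilon A1_{\varepsilon'}$ and each $X\in\mathrm{Im}(C)$ satisfies $X=1_\varepsilon X1_{\varepsilon'}$ for some $\varepsilon,\varepsilon'\in\mathcal{E}$. (A2) Write $C_{S,T}^b=C(S,b,T)$ for $S,T\in M(\lambda)$, $b\in B(\lambda)$. Then $*$ is an $\mathcal{A}$-linear involutory anti-automorphism of $A$ with $(C_{S,T}^b)^*=C_{T,S}^{\overline{b}}$. If $g=\sum_ic_ib_i$ with $b_i\in B(\lambda)$ and scalars $c_i$ (possibly involving $v$), $C_{S,T}^g$ denotes $\sum_ic_iC_{S,T}^{b_i}$. (A3) If $\lambda\in\Lambda$, $g\in\Gamma(\lambda)$, $S,T\in M(\lambda)$, then for all $a\in A$, $a\,C_{S,T}^g\equiv\sum_{S'\in M(\lambda)}C_{S',T}^{r_a(S',S)g}\bmod A(<\lambda)$, where $r_a(S',S)\in\mathcal{A}\otimes_{\mathbb{Z}}\Gamma(\lambda)$ is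 independent of $T$ and $g$, and $A(<\lambda)$ is the $\mathcal{A}$-span of all $C_{S'',T''}^{b''}$ with $S'',T''\in M(\mu)$, $b''\in B(\mu)$, $\mu<\lambda$. **The $\mathbf a$-function.** For $X,Y\in\mathrm{Im}(C)$ write $XY=\sum_{Z\in\mathrm{Im}(C)}g_{X,Y,Z}Z$. For $Z\in\mathrm{Im}(C)$ put $\mathbf{a}(Z)=\max_{X,Y\in\mathrm{Im}(C)}\deg(g_{X,Y,Z})$, where the degree of a Laurent polynomial is the highest power of $v$ occurring with nonzero coefficient. Let $\gamma_{X,Y,Z}\in\mathbb{Z}$ be the coefficient of $v^{\mathbf{a}(Z)}$ in $g_{X,Y,Z}$. **Tabular algebra with trace.** A tabular algebra which also satisfies: (A4) Let $K=C_{S,T}^b$, $K'=C_{U,V}^{b'}$, $K''=C_{X,Y}^{b''}$ lie in $\mathrm{Im}(C)$. Then the bound $\deg(g_{K,K',K''})=\mathbf{a}(K'')$ is achieved if and only if $X=S$, $T=U$, $Y=V$ and $b''\in\mathrm{supp}(bb')$. If these conditions all hold and furthermore $b=b'=b''=1$, then $\gamma_{K,K',K''}=1$. (A5) There is an $\mathcal{A}$-linear map $\tau:A\to\mathcal{A}$ (the tabular trace) with $\tau(x)=\tau(x^* )$ and $\tau(xy)=\tau(yx)$ for all $x,y\in A$, such that for every $\lambda\in\Lambda$, $S,T\in M(\lambda)$, $b\in B(\lambda)$ and $X=C_{S,T}^b$, $\tau(v^{\mathbf{a}(X)}X)\equiv1\bmod v^{-1}\mathcal{A}^-$ if $S=T$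 and $b=1$, and $\equiv0\bmod v^{-1}\mathcal{A}^-$ otherwise, where $\mathcal{A}^-=\mathbb{Z}[v^{-1}]$. *)

(* Defs.v *)
From HB Require Import structures.
From mathcomp Require Import all_boot all_order all_algebra finmap.
From mathcomp Require Import monalg.

Set Implicit Arguments.
Unset Strict Implicit.
Unset Printing Implicit Defensive.

Import Order.TTheory GRing.Theory Num.Theory.

Local Open Scope fset_scope.
Local Open Scope ring_scope.

(* Z[v, v^-1], as finitely supported functions int -> int: the coefficient of *)
(* v^n in p is p@_n.  The monoid-algebra product of monalg does not apply,    *)
(* since its monomials may not contain nontrivial units; the convolution      *)
(* product is therefore put on an alias.                                      *)
Definition laurent : Type := {malg int[int]}.

HB.instance Definition _ := GRing.Zmodule.copy laurent {malg int[int]}.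

Definition vpow (n : int) : laurent := << 1%R *g n >>.

Definition laurent_mul (p q : laurent) : laurent :=
  \sum_(i <- msupp p) \sum_(j <- msupp q) << p@_i * q@_j *g (i + j)%R >>.

Section LaurentRing.

Implicit Types (p q r : laurent).

Lemma laurent_mulEw (d1 d2 : {fset int}) p q :
  msupp p `<=` d1 -> msupp q `<=` d2 ->
  laurent_mul p q =
    \sum_(i <- d1) \sum_(j <- d2) << p@_i * q@_j *g (i + j)%R >>.
Proof.
move=> le_d1 le_d2; rewrite /laurent_mul (big_fset_incl _ le_d1) /=.
  apply/eq_bigr=> i _; apply/big_fset_incl => // k _ /mcoeff_outdom ->.
  by rewrite mulr0 monalgU0.
move=> k _ /mcoeff_outdom pk.
by rewrite big1 => // k' _; rewrite pk mul0r monalgU0.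
Qed.

Lemma laurent_mulC : commutative laurent_mul.
Proof.
move=> p q; rewrite /laurent_mul exchange_big; apply/eq_bigr=> i _.
by apply/eq_bigr=> j _; rewrite mulrC addrC.
Qed.

Lemma laurent_mulUU (c d i j : int) :
  laurent_mul << c *g i >> << d *g j >> = << c * d *g (i + j)%R >>.
Proof.
by rewrite (laurent_mulEw msuppU_le msuppU_le) !big_seq_fset1 !mcoeffUU.
Qed.

Lemma laurent_mulDl : left_distributive laurent_mul +%R.
Proof.
move=> p q r.
rewrite (laurent_mulEw (msuppD_le p q) (fsubset_refl _)).
rewrite (laurent_mulEw (fsubsetUl (msupp p) (msupp q)) (fsubset_refl _)).
rewrite (laurent_mulEw (fsubsetUr (msupp p) (msupp q)) (fsubset_refl _)).
rewrite -big_split /=; apply/eq_bigr=> i _.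
rewrite -big_split /=; apply/eq_bigr=> j _.
by rewrite mcoeffD mulrDl monalgUD.
Qed.

Lemma laurent_mulDr : right_distributive laurent_mul +%R.
Proof.
by move=> p q r; rewrite laurent_mulC laurent_mulDl !(laurent_mulC p).
Qed.

Lemma laurent_mul0l : left_zero (0 : laurent) laurent_mul.
Proof. by move=> p; rewrite /laurent_mul msupp0 big_seq_fset0. Qed.

Lemma laurent_mul0r : right_zero (0 : laurent) laurent_mul.
Proof. by move=> p; rewrite laurent_mulC laurent_mul0l. Qed.

Lemma laurent_mulUl (c i : int) q :
  laurent_mul << c *g i >> q =
    \sum_(j <- msupp q) << c * q@_j *g (i + j)%R >>.
Proof.
rewrite (laurent_mulEw msuppU_le (fsubset_refl _)) big_seq_fset1.
by apply/eq_bigr => j _; rewrite mcoeffUU.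
Qed.

Lemma laurent_mul1l : left_id (vpow 0) laurent_mul.
Proof.
move=> p; rewrite laurent_mulUl [RHS]monalgE.
by apply/eq_bigr => j _; rewrite mul1r add0r.
Qed.

Lemma laurent_mulEl p q :
  laurent_mul p q = \sum_(i <- msupp p) laurent_mul << p@_i *g i >> q.
Proof. by apply/eq_bigr=> i _; rewrite laurent_mulUl. Qed.

Lemma laurent_mulEr p q :
  laurent_mul p q = \sum_(j <- msupp q) laurent_mul p << q@_j *g j >>.
Proof.
rewrite laurent_mulC laurent_mulEl.
by apply/eq_bigr=> j _; rewrite laurent_mulC.
Qed.

Lemma laurent_mulA : associative laurent_mul.
Proof.
have suml r : {morph laurent_mul^~ r : x y / x + y}.
  by move=> x y; exact: laurent_mulDl.
have sumr p : {morph laurent_mul p : x y / x + y}.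
  by move=> x y; exact: laurent_mulDr.
move=> p q r.
rewrite [laurent_mul p q]laurent_mulEl.
rewrite [RHS](big_morph _ (suml _) (laurent_mul0l _)).
rewrite laurent_mulEl; apply/eq_bigr=> i _.
rewrite [laurent_mul q r]laurent_mulEl (big_morph _ (sumr _) (laurent_mul0r _)).
rewrite [laurent_mul _ q]laurent_mulEr.
rewrite [RHS](big_morph _ (suml _) (laurent_mul0l _)).
apply/eq_bigr=> j _.
rewrite [laurent_mul _ r in LHS]laurent_mulEr.
rewrite (big_morph _ (sumr _) (laurent_mul0r _)) [RHS]laurent_mulEr.
by apply/eq_bigr=> k _; rewrite !laurent_mulUU mulrA addrA.
Qed.

Lemma laurent_1neq0 : vpow 0 != 0.
Proof.
apply/eqP=> /(congr1 (fun p : laurent => p@_(0%R : int))) /eqP.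
by rewrite mcoeffUU (mcoeff0 (0%R : int)).
Qed.

End LaurentRing.

HB.instance Definition _ := GRing.Zmodule_isComNzRing.Build laurent
  laurent_mulA laurent_mulC laurent_mul1l laurent_mulDl laurent_1neq0.

(* The degree is a relation, so that 0 has no degree. *)
Definition has_deg (p : laurent) (n : int) : Prop :=
  p@_n != 0 /\ forall m : int, (n < m)%R -> p@_m = 0.

(* Z[v^-1] *)
Definition in_Aminus (p : laurent) : Prop :=
  forall n : int, (0 < n)%R -> p@_n = 0.

Definition eqmod_vinv (p q : laurent) : Prop :=
  exists2 r : laurent, in_Aminus r & p - q = vpow (- 1) * r.

Section Basis.

Variables (R : nzRingType) (V : lmodType R) (I : choiceType) (e : I -> V).

Definition lincomb (f : {malg R[I]}) : V := \sum_(i <- msupp f) f@_i *: e i.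

Record is_basis : Prop := IsBasis {
  is_basis_span : forall x : V, exists f : {malg R[I]}, lincomb f == x;
  is_basis_free : forall f : {malg R[I]}, lincomb f = 0 -> f = 0 }.

Definition basis_coord (eb : is_basis) (x : V) : {malg R[I]} :=
  xchoose (is_basis_span eb x).

End Basis.

Record table_algebra := TableAlgebra {
  ta_alg :> algType int;
  ta_basis : {pred ta_alg};
  ta_bar : ta_alg -> ta_alg;
  ta_basisP : is_basis (fun b : {x : ta_alg | x \in ta_basis} => val b);
  ta_basis1 : 1 \in ta_basis;
  ta_nneg : forall b c d : {x : ta_alg | x \in ta_basis},
    (0 <= (basis_coord ta_basisP (val b * val c))@_d)%R;
  ta_bar_linear : linear ta_bar;
  ta_barM : forall x y, ta_bar (x * y) = ta_bar y * ta_bar x;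
  ta_barK : involutive ta_bar;
  ta_bar_basis : forall x, (ta_bar x \in ta_basis) = (x \in ta_basis);
  ta_kappa : forall b b' b'' : {x : ta_alg | x \in ta_basis},
    (basis_coord ta_basisP (val b * val b'))@_b'' =
    (basis_coord ta_basisP (val b'' * ta_bar (val b')))@_b }.

Section TableAlgebra.

Variable G : table_algebra.

Definition tbasis := {x : G | x \in @ta_basis G}.

Definition tone : tbasis := exist _ 1 (ta_basis1 G).

Lemma tbar_subproof (b : tbasis) : ta_bar (val b) \in @ta_basis G.
Proof. by rewrite ta_bar_basis (valP b). Qed.

Definition tbar (b : tbasis) : tbasis :=
  exist _ (ta_bar (val b)) (tbar_subproof b).

Definition kappa (b : tbasis) (g : G) : int := (basis_coord (ta_basisP G) g)@_b.

Definition tsupp (g : G) : {fset tbasis} := msupp (basis_coord (ta_basisP G) g).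

(* The extension of scalars of G to Z[v, v^-1]: since the table basis is a    *)
(* Z-basis of G, the tensor product is free over Z[v, v^-1] on that basis.    *)
Definition tensor := {malg laurent[tbasis]}.

(* g |-> 1 (x) g *)
Definition tensor_in (g : G) : tensor :=
  \sum_(b <- tsupp g) << (kappa b g)%:~R *g b >>.

Definition tensor_mul (r s : tensor) : tensor :=
  \sum_(b <- msupp r) \sum_(c <- msupp s)
    (r@_b * s@_c) *: tensor_in (val b * val c).

End TableAlgebra.

(* Associative algebras that are not assumed to have an identity element. *)
Record nu_algebra (R : comNzRingType) := NuAlgebra {
  nu_mod :> lmodType R;
  nu_mul : nu_mod -> nu_mod -> nu_mod;
  nu_mulA : associative nu_mul;
  nu_mul_linearl : forall y, linear (nu_mul^~ y);
  nu_mul_linearr : forall x, linear (nu_mul x) }.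

Notation "x ** y" := (nu_mul x y) (at level 40, left associativity).

Record table_datum (A : nu_algebra laurent) := TableDatum {
  td_disp : Order.disp_t;
  td_Lambda : finPOrderType td_disp;
  td_Gamma : td_Lambda -> table_algebra;
  td_M : td_Lambda -> finType;
  td_C : {l : td_Lambda & (td_M l * tbasis (td_Gamma l) * td_M l)%type} -> A;
  td_star : A -> A }.

Section Tabular.

Variables (A : nu_algebra laurent) (D : table_datum A).

Local Notation Lambda := (td_Lambda D).
Local Notation Gamma := (@td_Gamma A D).
Local Notation M := (@td_M A D).
Local Notation C := (@td_C A D).
Local Notation star := (@td_star A D).

(* Indexes the tabular basis Im(C), through the injection C. *)
Definition tix := {l : Lambda & (M l * tbasis (Gamma l) * M l)%type}.

Definition mkix (l : Lambda) (S : M l) (b : tbasis (Gamma l)) (T : M l) : tix :=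
  existT _ l (S, b, T).

(* C_{S,T}^g, for g with scalars in Z[v, v^-1] *)
Definition Cext (l : Lambda) (S T : M l) (g : tensor (Gamma l)) : A :=
  \sum_(b <- msupp g) g@_b *: C (mkix S b T).

(* A(< l) *)
Definition in_lower (l : Lambda) (x : A) : Prop :=
  exists2 f : {malg laurent[tix]},
    forall i, i \in msupp f -> (tag i < l)%O & x = lincomb C f.

Record is_tabular : Prop := IsTabular {
  tab_C_inj : injective C;
  tab_basis : is_basis C;
  tab_idem : exists E : tix -> Prop,
    [/\ forall i, E i -> C i ** C i = C i,
        forall i j, E i -> E j -> i <> j -> C i ** C j = 0,
        forall x : A, exists2 s : seq (tix * A * tix),
          forall t, t \in s -> E t.1.1 /\ E t.2
          & x = \sum_(t <- s) C t.1.1 ** t.1.2 ** C t.2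
      & forall k, exists i j, [/\ E i, E j & C k = C i ** C k ** C j]];
  tab_star_linear : linear star;
  tab_starK : involutive star;
  tab_starM : forall x y, star (x ** y) = star y ** star x;
  tab_starC : forall l (S T : M l) (b : tbasis (Gamma l)),
    star (C (mkix S b T)) = C (mkix T (tbar b) S);
  tab_mul : forall (l : Lambda) (x : A),
    exists r : M l -> M l -> tensor (Gamma l),
      forall (S T : M l) (g : Gamma l),
        in_lower l (x ** Cext S T (tensor_in g) -
          \sum_(S' : M l) Cext S' T (tensor_mul (r S' S) (tensor_in g))) }.

Section Trace.

Hypothesis HD : is_tabular.

Definition gcoef (X Y Z : tix) : laurent :=
  (basis_coord (tab_basis HD) (C X ** C Y))@_Z.

(* a Z is the maximum of the degrees of the gcoef X Y Z; in particular the    *)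
(* maximum exists.                                                            *)
Definition is_afun (a : tix -> int) : Prop := forall Z,
  (exists X Y, has_deg (gcoef X Y Z) (a Z)) /\
  (forall X Y (n : int), has_deg (gcoef X Y Z) n -> (n <= a Z)%R).

Definition gammacoef (a : tix -> int) (X Y Z : tix) : int :=
  (gcoef X Y Z)@_(a Z).

Record is_tabular_trace (a : tix -> int) (tau : A -> laurent) : Prop :=
  IsTabularTrace {
  tr_afun : is_afun a;
  (* The sets M l are disjoint for distinct l, so that an equality such as    *)
  (* X = S forces the same l.                                                 *)
  tr_bound : forall K K' K'' : tix,
    has_deg (gcoef K K' K'') (a K'') <->
    exists (l : Lambda) (S T Y : M l) (b b' b'' : tbasis (Gamma l)),
      [/\ K = mkix S b T, K' = mkix T b' Y, K'' = mkix S b'' Y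
        & b'' \in tsupp (val b * val b')];
  tr_gamma : forall (l : Lambda) (S T Y : M l),
    gammacoef a (mkix S (tone (Gamma l)) T) (mkix T (tone (Gamma l)) Y)
      (mkix S (tone (Gamma l)) Y) = 1;
  tr_linear : scalar tau;
  tr_star : forall x, tau x = tau (star x);
  tr_sym : forall x y, tau (x ** y) = tau (y ** x);
  tr_mod : forall (l : Lambda) (S T : M l) (b : tbasis (Gamma l)),
    let X := mkix S b T in
    eqmod_vinv (tau (vpow (a X) *: C X))
      (if (S == T) && (b == tone (Gamma l)) then 1 else 0) }.

End Trace.

Definition trform (tau : A -> laurent) (x y : A) : laurent := tau (x ** star y).

End Tabular.

(* Main.v *)
(** Each term g_{X,Y,Z} tau(Z) of tau(XY) has degree at most 0, with constant
    term gamma_{X,Y,Z} if Z = C_{S,S}^1 and 0 otherwise.  By (A4) and (T3) this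
    vanishes unless Y = X^*, so the point is that gamma_{X,X^*,Z} = 1 for
    X = C_{S,T}^b and Z = C_{S,S}^1, whereas (A4) only gives this for b = 1.
    By (A3) the products C_{S,T}^b C_{T,S}^g are, modulo lower terms,
    C_{S,S}^{rg} with r independent of g; comparing g = bar b with g = 1 by means
    of (T3),
      g(C_{S,T}^b, C_{T,S}^{bar b}, C_{S,S}^1) = g(C_{S,T}^b, C_{T,S}^1, C_{S,S}^b).
    Equating degrees shows a(C_{S,S}^b) = a(C_{S,S}^1).  Applying * to the right
    side and using (A3) again, now for C_{S,T}^1, only the leading term of the
    b = 1 coefficient contributes in that common degree, and it is 1.
    Nondegeneracy follows by pairing x with a basis element at which the
    coordinate of x has maximal degree. *)

Require Import Defs.
From HB Require Import structures.
From mathcomp Require Import all_boot all_order all_algebra finmap.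
From mathcomp Require Import monalg ring.

Set Implicit Arguments.
Unset Strict Implicit.

Import Order.TTheory GRing.Theory Num.Theory.

Local Open Scope fset_scope.
Local Open Scope ring_scope.

(** * Coordinates with respect to a basis *)

Lemma sum_delta (R : nzRingType) (I : choiceType) (f : {malg R[I]}) (i : I) :
  \sum_(j <- msupp f) f@_j * (j == i)%:R = f@_i.
Proof.
have [fi|/[dup] fi /mcoeff_outdom ->] := boolP (i \in msupp f).
  rewrite (bigD1_seq i) ?fset_uniq //= eqxx mulr1 big1 ?addr0 // => j /negPf ->.
  by rewrite mulr0.
rewrite big1_seq // => j /andP[_ fj].
by case: eqP fj fi => [-> ->//|_ _ _]; rewrite mulr0.
Qed.

Section BasisTheory.

Variables (R : nzRingType) (V : lmodType R) (I : choiceType) (e : I -> V).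
Implicit Type f : {malg R[I]}.

Lemma lincombEw (d : {fset I}) f :
  msupp f `<=` d -> lincomb e f = \sum_(i <- d) f@_i *: e i.
Proof.
move=> le_d; rewrite /lincomb (big_fset_incl _ le_d) //= => i _.
by move/mcoeff_outdom => ->; rewrite scale0r.
Qed.

Lemma lincomb_is_linear : linear (lincomb e).
Proof.
move=> c f g; set d := msupp (c *: f + g) `|` (msupp f `|` msupp g).
rewrite !(@lincombEw d); first last.
- by rewrite fsubsetUl.
- by rewrite fsubsetU // fsubsetUl orbT.
- by rewrite fsubsetU // fsubsetUr orbT.
rewrite scaler_sumr -big_split /=; apply/eq_bigr => i _.
by rewrite mcoeffD mcoeffZ scalerDl scalerA.
Qed.

HB.instance Definition _ :=
  GRing.isLinear.Build R {malg R[I]} V *:%R (lincomb e) lincomb_is_linear.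

Lemma lincombU c i : lincomb e << c *g i >> = c *: e i.
Proof. by rewrite (lincombEw msuppU_le) big_seq_fset1 mcoeffUU. Qed.

Hypothesis eb : is_basis e.

Lemma basis_coordK : cancel (basis_coord eb) (lincomb e).
Proof. by move=> x; apply/eqP/(xchooseP (is_basis_span eb x)). Qed.

Lemma lincomb_inj : injective (lincomb e).
Proof.
move=> f g fg; apply/eqP; rewrite -subr_eq0; apply/eqP/(is_basis_free eb).
by rewrite linearB /= fg subrr.
Qed.

Lemma lincombK : cancel (lincomb e) (basis_coord eb).
Proof. by move=> f; apply: lincomb_inj; rewrite basis_coordK. Qed.

Lemma basis_coord_is_linear : linear (basis_coord eb).
Proof.
by move=> c x y; apply: lincomb_inj; rewrite linearP /= !basis_coordK.
Qed.

HB.instance Definition _ :=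
  GRing.isLinear.Build R V {malg R[I]} *:%R (basis_coord eb)
    basis_coord_is_linear.

Lemma basis_coordU i : basis_coord eb (e i) = << 1 *g i >>.
Proof. by apply: lincomb_inj; rewrite basis_coordK lincombU scale1r. Qed.

Lemma mcoeff_basis_coord i j : (basis_coord eb (e i))@_j = (i == j)%:R.
Proof. by rewrite basis_coordU mcoeffU. Qed.

End BasisTheory.

(** * Degrees and leading coefficients of Laurent polynomials *)

Implicit Types p q : laurent.

(** Unlike [has_deg], this bound holds for the zero polynomial with every [n], which makes it stable
    under sums and products. *)
Definition deg_le (p : laurent) (n : int) : Prop :=
  forall m : int, n < m -> p@_m = 0.

Lemma deg_le_sum (I : eqType) (r : seq I) (F : I -> laurent) n :
  (forall i, i \in r -> deg_le (F i) n) -> deg_le (\sum_(i <- r) F i) n.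
Proof.
move=> dF m nm; rewrite raddf_sum big1_seq // => i /andP[_ ir].
exact: dF.
Qed.

Lemma mcoeff_laurent_mul (p q : laurent) (n : int) :
  (p * q)@_n = \sum_(i <- msupp p) p@_i * q@_(n - i).
Proof.
rewrite [p * q]laurent_mulEl raddf_sum; apply/eq_bigr => i _ /=.
rewrite laurent_mulUl raddf_sum /=.
transitivity (\sum_(j <- msupp q | j == n - i) p@_i * q@_(n - i)).
  rewrite [RHS]big_mkcond; apply/eq_bigr => j _ /=.
  rewrite mcoeffU (addrC i) -[_ + i == n]eq_sym -subr_eq eq_sym.
  by case: eqP => [->|_] //; rewrite mulr1n.
rewrite big_const_seq count_uniq_mem ?fset_uniq //.
have [//|/mcoeff_outdom ->] := boolP (n - i \in msupp q); last by rewrite mulr0.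
by rewrite /= addr0.
Qed.

(** In the convolution an index [k] above [i] kills the factor from [p], and one below [i] leaves an
    exponent above [j], which kills the factor from [q]. *)
Lemma mcoeffM_deg_le p q i j :
  deg_le p i -> deg_le q j -> (p * q)@_(i + j) = p@_i * q@_j.
Proof.
move=> dp dq; rewrite mcoeff_laurent_mul.
have zero k : k != i -> p@_k * q@_(i + j - k) = 0.
  rewrite neq_lt => /orP[ki|/dp ->]; last by rewrite mul0r.
  by rewrite dq ?mulr0 // addrAC ltrDr subr_gt0.
have [iin|/mcoeff_outdom pi0] := boolP (i \in msupp p); last first.
  rewrite pi0 mul0r big1 // => k _.
  by have [->|/zero //] := eqVneq k i; rewrite pi0 mul0r.
rewrite (bigD1_seq i) ?fset_uniq //= big1 => [|k /zero //].
by rewrite addr0 addrAC subrr add0r.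
Qed.

Lemma deg_leM p q i j : deg_le p i -> deg_le q j -> deg_le (p * q) (i + j).
Proof.
move=> dp dq n lt_n; rewrite mcoeff_laurent_mul big1 // => k _.
have [ik|ki] := ltP i k; first by rewrite dp ?mul0r.
by rewrite dq ?mulr0 // ltrBrDr (le_lt_trans _ lt_n) // addrC lerD2r.
Qed.

Lemma mcoeff_vpowM k p (n : int) : (vpow k * p)@_n = p@_(n - k).
Proof.
rewrite mcoeff_laurent_mul (big_fset_incl _ msuppU_le) => [|i _ /mcoeff_outdom->].
  by rewrite big_seq_fset1 mcoeffUU mul1r.
by rewrite mul0r.
Qed.

Lemma mcoeff_mul_intr p (z : int) (n : int) : (p * z%:~R)@_n = p@_n * z.
Proof. by rewrite mulrzr raddfMz -mulrzr intz. Qed.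

Lemma mcoeff_laurent1 n : @mcoeff int int n (1 : laurent) = (n == 0)%:R.
Proof. by rewrite -[1]/(vpow 0) mcoeffU eq_sym. Qed.

Lemma eqmod_vinvP p q :
  eqmod_vinv p q <-> forall n, 0 <= n -> p@_n = q@_n.
Proof.
split=> [[r rA pqr] n n0|pq].
  apply/eqP; rewrite -subr_eq0 -mcoeffB pqr mcoeff_vpowM opprK.
  by rewrite rA // ltr_wpDl.
(* Multiplication by [v] is the only possible choice, since [v] is a unit. *)
exists (vpow 1 * (p - q)).
  move=> n n0; rewrite mcoeff_vpowM mcoeffB pq ?subrr //.
  by rewrite subr_ge0 -gtz0_ge1.
apply/malgP => n; rewrite !mcoeff_vpowM; congr (_@__); ring.
Qed.

Lemma ex_max_fset (E : {fset int}) m :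
  m \in E -> exists2 n, n \in E & forall k, k \in E -> k <= n.
Proof.
move=> mE; have [n _ nmax] := @arg_maxP _ _ _ [` mE] xpredT (fun i => val i) isT.
by exists (val n) => [|k kE]; [exact: valP | exact: (nmax [` kE])].
Qed.

Lemma ex_has_deg p m : p@_m != 0 -> exists2 n, m <= n & has_deg p n.
Proof.
rewrite mcoeff_neq0 => mp; have [n np nmax] := ex_max_fset mp.
exists n; first exact: nmax.
split=> [|k nk]; first by rewrite mcoeff_neq0.
by apply: mcoeff_outdom; apply/negP => /nmax; rewrite leNgt nk.
Qed.

Lemma ex_mcoeff_neq0 (I : choiceType) (V : zmodType) (f : {malg V[I]}) :
  f != 0 -> exists i, f@_i != 0.
Proof.
move=> f0; have /fset0Pn[i fi] : msupp f != fset0.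
  apply: contraNneq f0 => supp0; apply/eqP/malgP => i.
  by rewrite mcoeff0 mcoeff_outdom // supp0.
by exists i; rewrite mcoeff_neq0.
Qed.

(** Selects the test vector for nondegeneracy: only finitely many exponents occur in the coordinates
    of [f], so one of them is the largest. *)
Lemma ex_max_deg (I : choiceType) (f : {malg laurent[I]}) :
  f != 0 -> exists i n, (f@_i)@_n != 0 /\ forall k, deg_le (f@_k) n.
Proof.
move=> f0; pose E := (\bigcup_(k <- msupp f) msupp (f@_k : laurent))%fset.
have inE i m : (f@_i : laurent)@_m != 0 -> m \in E.
  move=> fim; apply/bigfcupP; exists i; last by rewrite -mcoeff_neq0.
  by rewrite andbT -mcoeff_neq0; apply: contraNneq fim => ->; rewrite mcoeff0.
have [i /ex_mcoeff_neq0[m fim]] := ex_mcoeff_neq0 f0.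
have [n /bigfcupP[k _ nk] nmax] := ex_max_fset (inE i m fim).
exists k, n; split=> [|k' m' nm']; first by rewrite mcoeff_neq0.
by apply/eqP/negPn/negP => /inE/nmax; rewrite leNgt nm'.
Qed.

(** * Table algebras and their extension of scalars *)

Section TableAlgebraTheory.

Variable G : table_algebra.
Implicit Types b c d : tbasis G.

Lemma kappa_basis b c : kappa c (val b) = (b == c)%:R.
Proof. by rewrite /kappa mcoeff_basis_coord. Qed.

Lemma ta_bar1 : ta_bar (1 : G) = 1.
Proof.
by rewrite -[LHS]mulr1 -[X in _ * X](ta_barK (t := G)) -ta_barM mulr1 ta_barK.
Qed.

Lemma tbar_tone : tbar (tone G) = tone G.
Proof. by apply: val_inj; exact: ta_bar1. Qed.

Lemma tbarK : involutive (@tbar G).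
Proof. by move=> b; apply: val_inj; exact: ta_barK. Qed.

(** By [ta_kappa] the coefficient is that of [b] in [1] times the bar of [c], which is itself a
    basis element. *)
Lemma kappa_tone_mul b c : kappa (tone G) (val b * val c) = (b == tbar c)%:R.
Proof.
rewrite /kappa (ta_kappa b c) /= mul1r.
by rewrite -[ta_bar _]/(val (tbar c)) -/(kappa _ _) kappa_basis eq_sym.
Qed.

Lemma tensor_inU b : tensor_in (val b) = << 1 *g b >>.
Proof.
rewrite /tensor_in /tsupp basis_coordU (big_fset_incl _ msuppU_le) => [|c _].
  by rewrite big_seq_fset1 kappa_basis eqxx.
rewrite -[<< 1 *g b >>](basis_coordU (ta_basisP G)) => /mcoeff_outdom.
by rewrite -/(kappa _ _) => ->; rewrite monalgU0.
Qed.

Lemma mcoeff_tensor_in (g : G) b : (tensor_in g)@_b = (kappa b g)%:~R.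
Proof.
rewrite -[in RHS](basis_coordK (ta_basisP G) g) /tensor_in raddf_sum /=.
under eq_bigr => c _ do rewrite mcoeffU -mulr_natr.
transitivity (\sum_(c <- tsupp g) (kappa c g * (c == b)%:R)%:~R : laurent).
  by apply/eq_bigr => c _; rewrite rmorphM rmorph_nat.
by rewrite -raddf_sum sum_delta basis_coordK.
Qed.

Lemma mcoeff_tensor_mul (r : tensor G) b c :
  (tensor_mul r (tensor_in (val b)))@_c =
  \sum_(d <- msupp r) r@_d * (kappa c (val d * val b))%:~R.
Proof.
rewrite raddf_sum; apply/eq_bigr => d _ /=.
rewrite tensor_inU (big_fset_incl _ msuppU_le) => [|k _ /mcoeff_outdom ->].
  by rewrite big_seq_fset1 mcoeffUU mulr1 mcoeffZ mcoeff_tensor_in.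
by rewrite mulr0 scale0r.
Qed.

End TableAlgebraTheory.

(** * Structure constants of a tabular algebra *)

Section TabularTheory.

Variables (A : nu_algebra laurent) (D : table_datum A).
Hypothesis HD : is_tabular D.

Local Notation Lambda := (td_Lambda D).
Local Notation Gamma := (@td_Gamma A D).
Local Notation M := (@td_M A D).
Local Notation coord x := (basis_coord (tab_basis HD) x).
Local Notation one l := (tone (Gamma l)).

Lemma mkix_eqE (l : Lambda) (S S' T T' : M l) (b b' : tbasis (Gamma l)) :
  (mkix S b T == mkix S' b' T') = [&& S == S', b == b' & T == T'].
Proof.
by rewrite -[mkix S' _ _]/(Tagged _ _) eq_Tagged /= !xpair_eqE andbA.
Qed.

Definition ixstar (k : tix D) : tix D :=
  mkix (tagged k).2 (tbar (tagged k).1.2) (tagged k).1.1.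

Lemma ixstarK : involutive ixstar.
Proof. by case=> l [[S b] T]; rewrite /ixstar /= tbarK. Qed.

Lemma star_tabular k : td_star D (td_C k) = td_C (ixstar k).
Proof. by case: k => l [[S b] T]; exact: (tab_starC HD). Qed.

Lemma coord_star (x : A) k :
  (coord (td_star D x))@_(ixstar k) = (coord x)@_k.
Proof.
rewrite -{1}[x](basis_coordK (tab_basis HD)).
(* Packing the involution as a linear map lets it distribute over the expansion of [x]; it then
   merely permutes the basis by [ixstar]. *)
pose star : {linear A -> A} := HB.pack (td_star D)
  (GRing.isLinear.Build laurent A A *:%R (td_star D) (tab_star_linear HD)).
have starZ c i : td_star D (c *: td_C i) = c *: td_C (ixstar i).
  by rewrite -star_tabular; exact: (linearZ_LR star).
rewrite -[td_star D]/(star : A -> A) raddf_sum raddf_sum raddf_sum /=.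
under eq_bigr => i _ do
  rewrite starZ linearZ mcoeffZ mcoeff_basis_coord (can_eq ixstarK).
exact: sum_delta.
Qed.

Lemma gcoef_star K K' K'' :
  gcoef HD K K' K'' = gcoef HD (ixstar K') (ixstar K) (ixstar K'').
Proof.
by rewrite /gcoef -!star_tabular -(tab_starM HD) coord_star.
Qed.

Lemma coord_lower (l : Lambda) (x : A) S (b : tbasis (Gamma l)) T :
  in_lower (D := D) l x -> (coord x)@_(mkix S b T) = 0.
Proof.
case=> f lt_f ->; rewrite lincombK; apply: mcoeff_outdom.
by apply/negP => /lt_f; rewrite /= ltxx.
Qed.

Lemma coord_Cext (l : Lambda) (S S' T : M l) (g : tensor (Gamma l)) b :
  (coord (Cext S' T g))@_(mkix S b T) = if S' == S then g@_b else 0.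
Proof.
rewrite raddf_sum raddf_sum /=.
under eq_bigr => d _ do
  rewrite linearZ mcoeffZ mcoeff_basis_coord mkix_eqE eqxx andbT.
case: (S' == S) => /=; last by rewrite big1 // => d _; rewrite mulr0.
exact: sum_delta.
Qed.

(** This is [tab_mul] read at indices of layer [l], where lower terms have no coordinates. That one
    [r] serves all [b] is what allows different right factors to be compared. *)
Lemma gcoef_tensor (l : Lambda) K (S T Y : M l) :
  exists r : tensor (Gamma l), forall b b',
    gcoef HD K (mkix T b Y) (mkix S b' Y) =
    \sum_(d <- msupp r) r@_d * (kappa b' (val d * val b))%:~R.
Proof.
have [r rP] := tab_mul HD l (td_C K); exists (r S T) => b b'.
have lowP := coord_lower S b' Y (rP T Y (val b)).
have CextU : Cext T Y (tensor_in (val b)) = td_C (mkix T b Y).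
  rewrite tensor_inU [LHS](big_fset_incl _ msuppU_le) => [|c _ /mcoeff_outdom->].
    by rewrite big_seq_fset1 mcoeffUU scale1r.
  by rewrite scale0r.
rewrite CextU linearB mcoeffB in lowP.
rewrite /gcoef (subr0_eq lowP).
rewrite raddf_sum raddf_sum (bigD1 S) //= big1 => [|S' /negPf S'S].
  by rewrite addr0 coord_Cext eqxx mcoeff_tensor_mul.
by rewrite coord_Cext S'S.
Qed.

End TabularTheory.

(** * Leading coefficients and the trace *)

Section TraceTheory.

Variables (A : nu_algebra laurent) (D : table_datum A).
Hypothesis HD : is_tabular D.
Variables (a : tix D -> int) (tau : A -> laurent).
Hypothesis Htau : is_tabular_trace HD a tau.

Local Notation Lambda := (td_Lambda D).
Local Notation Gamma := (@td_Gamma A D).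
Local Notation M := (@td_M A D).
Local Notation one l := (tone (Gamma l)).

Lemma gcoef_deg_le K K' K'' : deg_le (gcoef HD K K' K'') (a K'').
Proof.
move=> m lt_m; apply/eqP/negPn/negP => /ex_has_deg[n le_n dn].
have [_ le_a] := tr_afun Htau K''.
by have := le_a _ _ _ dn; rewrite leNgt (lt_le_trans lt_m le_n).
Qed.

(** The degree never exceeds [a K''], so attaining it means exactly that the coefficient there is
    nonzero; [tr_bound] then applies. *)
Lemma gammacoef_neq0P K K' K'' :
  gammacoef HD a K K' K'' != 0 <->
  exists (l : Lambda) (S T Y : M l) (b b' b'' : tbasis (Gamma l)),
    [/\ K = mkix S b T, K' = mkix T b' Y, K'' = mkix S b'' Y
      & b'' \in tsupp (val b * val b')].
Proof.
split=> [nz|/(tr_bound Htau)[] //]; apply/(tr_bound Htau).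
by split=> //; exact: gcoef_deg_le.
Qed.

(** Taking the right factor with [b = 1] collapses the sum to one term, which identifies the
    coefficients of [r] as structure constants. *)
Lemma gcoef_tone (l : Lambda) K (S T Y : M l) :
  exists r : tensor (Gamma l),
    (forall b, r@_b = gcoef HD K (mkix T (one l) Y) (mkix S b Y)) /\
    forall b b', gcoef HD K (mkix T b Y) (mkix S b' Y) =
      \sum_(d <- msupp r) r@_d * (kappa b' (val d * val b))%:~R.
Proof.
have [r rP] := gcoef_tensor HD K S T Y; exists r; split=> // b; rewrite rP.
rewrite -[LHS]sum_delta; apply: eq_bigr => d _.
by rewrite mulr1 kappa_basis rmorph_nat.
Qed.

(** The coefficient of [1] in [d] times the bar of [b] is nonzero only for [d = b], so both sides
    equal [r@_b]. *)
Lemma gcoef_tbar (l : Lambda) K (S T Y : M l) (b : tbasis (Gamma l)) :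
  gcoef HD K (mkix T (tbar b) Y) (mkix S (one l) Y) =
  gcoef HD K (mkix T (one l) Y) (mkix S b Y).
Proof.
have [r [r1 ->]] := gcoef_tone K S T Y.
rewrite -r1 -[RHS]sum_delta; apply: eq_bigr => d _.
by rewrite kappa_tone_mul tbarK rmorph_nat.
Qed.

Lemma tone_tsupp_mul (l : Lambda) (b b' : tbasis (Gamma l)) :
  (one l \in tsupp (val b * val b')) = (b == tbar b').
Proof.
rewrite -mcoeff_neq0 -[X in X != 0]/(kappa _ _) kappa_tone_mul.
by rewrite pnatr_eq0 eqb0 negbK.
Qed.

Lemma has_deg_unique p m n : has_deg p m -> has_deg p n -> m = n.
Proof.
move=> [pm dm] [pn dn]; case: (ltgtP m n) => // [/dm|/dn] p0.
  by rewrite p0 eqxx in pn.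
by rewrite p0 eqxx in pm.
Qed.

(** By [gcoef_tbar] a single polynomial is a structure constant for both targets, and by [tr_bound]
    it attains the bound at each. *)
Lemma afun_diag (l : Lambda) (S : M l) (b : tbasis (Gamma l)) :
  a (mkix S b S) = a (mkix S (one l) S).
Proof.
have deg1 : has_deg (gcoef HD (mkix S b S) (mkix S (one l) S) (mkix S b S))
    (a (mkix S b S)).
  apply/(tr_bound Htau); exists l, S, S, S, b, (one l), b; split=> //.
  rewrite -mcoeff_neq0 -[X in X != 0]/(kappa _ _) mulr1 kappa_basis eqxx.
  by [].
apply: has_deg_unique deg1 _; rewrite -gcoef_tbar; apply/(tr_bound Htau).
exists l, S, S, S, b, (tbar b), (one l); split=> //.
by rewrite tone_tsupp_mul tbarK.
Qed.

Lemma gammacoef_bar (l : Lambda) (S T : M l) (b : tbasis (Gamma l)) :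
  gammacoef HD a (mkix S b T) (mkix T (tbar b) S) (mkix S (one l) S) = 1.
Proof.
rewrite /gammacoef gcoef_tbar gcoef_star /ixstar /= tbar_tone.
(* The involution has moved [1] to the left factor and the bar of [b] to the right one, so the
   expansion now has coefficients [r@_d] coming from a product of two elements with [b = 1]. *)
have [r [r1 ->]] := gcoef_tone (mkix S (one l) T) S T S.
transitivity (\sum_(d <- msupp r) r@_d * (d == one l)%:R : laurent)@_(
  a (mkix S (one l) S)); last by rewrite sum_delta r1; exact: (tr_gamma Htau).
rewrite !raddf_sum; apply: eq_bigr => d _.
rewrite [LHS]mcoeff_mul_intr -[(d == one l)%:R](rmorph_nat intr) [RHS]mcoeff_mul_intr.
have [->|d1] := eqVneq d (one l); first by rewrite [val _ * _]mul1r kappa_basis eqxx.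
rewrite mulr0; suff -> : r@_d@_(a (mkix S (one l) S)) = 0 by rewrite mul0r.
(* By [afun_diag] the exponent is also the bound for the target with [d], so a nonzero coefficient
   would put [d] in the support of [1 * 1]. *)
rewrite r1 -(afun_diag S d); apply/eqP/negPn/negP => /gammacoef_neq0P.
move=> [l' [S' [T' [Y' [b1 [b2 [b3 [E1 E2 E3]]]]]]]].
(* Once the layers agree, the components of the indices can be compared. *)
have El : l = l' := congr1 tag E1; subst l'.
move/eqP: E1; rewrite mkix_eqE => /and3P[_ /eqP <- _].
move/eqP: E2; rewrite mkix_eqE => /and3P[_ /eqP <- _].
move/eqP: E3; rewrite mkix_eqE => /and3P[_ /eqP <- _].
rewrite -mcoeff_neq0 -[X in X != 0]/(kappa _ _) mulr1 kappa_basis.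
by rewrite [one l == d]eq_sym (negPf d1).
Qed.

Lemma eqmod_tau (k : tix D) :
  deg_le (tau (td_C k)) (- a k) /\
  (tau (td_C k))@_(- a k) =
    (((tagged k).1.1 == (tagged k).2) && ((tagged k).1.2 == one (tag k)))%:R.
Proof.
case: k => l [[S b] T] /=; have /eqmod_vinvP tauP := tr_mod Htau S T b.
have tauZ c x : tau (c *: x) = c * tau x.
  pose t : {scalar A} := HB.pack tau
    (GRing.isLinear.Build laurent A laurent *%R tau (tr_linear Htau)).
  exact: (linearZ_LR t).
have tauE n : (tau (td_C (mkix S b T)))@_n =
    (vpow (a (mkix S b T)) * tau (td_C (mkix S b T)))@_(n + a (mkix S b T)).
  by rewrite mcoeff_vpowM addrK.
split=> [n lt_n|]; rewrite tauE -tauZ tauP ?addNr //.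
- case: ifP => _; last exact: mcoeff0.
  by rewrite mcoeff_laurent1 gt_eqF // -ltrBlDr sub0r.
- by rewrite -lerBlDr sub0r ltW.
- by case: ifP => _; [rewrite mcoeff_laurent1 | exact: mcoeff0].
Qed.

Lemma tau_lincomb f : tau (lincomb (@td_C A D) f) =
  \sum_(k <- msupp f) f@_k * tau (td_C k).
Proof.
pose t : {scalar A} := HB.pack tau
  (GRing.isLinear.Build laurent A laurent *%R tau (tr_linear Htau)).
rewrite -[tau]/(t : A -> laurent) raddf_sum; apply: eq_bigr => k _.
exact: linearZ_LR.
Qed.

(** In each term of the expansion the bounds [a k] and [- a k] cancel, so the constant term is a sum
    of products of leading coefficients. *)
Lemma mcoeff0_tau_mul (i j : tix D) :
  deg_le (tau (td_C i ** td_C j)) 0 /\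
  (tau (td_C i ** td_C j))@_0 = (i == ixstar j)%:R.
Proof.
rewrite -[_ ** _](basis_coordK (tab_basis HD)) tau_lincomb.
set f := basis_coord _ _.
have df k : deg_le (f@_k) (a k) by exact: gcoef_deg_le.
split.
  apply: deg_le_sum => k _; rewrite -(subrr (a k)).
  by apply: deg_leM => //; have [] := eqmod_tau k.
rewrite raddf_sum /=.
pose F k := gammacoef HD a i j k *
    (((tagged k).1.1 == (tagged k).2) && ((tagged k).1.2 == one (tag k)))%:R.
transitivity (\sum_(k <- msupp f) F k).
  apply: eq_bigr => k _; have [dtau tauE] := eqmod_tau k.
  by rewrite -(subrr (a k)) mcoeffM_deg_le // tauE.
(* The trace factor forces a diagonal [k] with middle entry [1]; then [tr_bound] and
   [tone_tsupp_mul] force the two factors to be exchanged by [ixstar]. *)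
have Fneq0 k : F k != 0 ->
    i = ixstar j /\ k = mkix (tagged i).1.1 (one (tag i)) (tagged i).1.1.
  rewrite /F; have [->|/gammacoef_neq0P] := eqVneq (gammacoef HD a i j k) 0.
    by rewrite mul0r eqxx.
  move=> [l [S [T [Y [b [b' [b'' [-> -> -> bb']]]]]]]] /=.
  have [SY|_] := eqVneq S Y; last by rewrite /= mulr0 eqxx.
  have [b1|_] := eqVneq b'' (one l); last by rewrite /= mulr0 eqxx.
  subst; move: bb'; rewrite tone_tsupp_mul => /eqP -> _.
  by [].
have [ij|/eqP ij] := boolP (i == ixstar j); last first.
  by rewrite big1 // => k _; apply/eqP/negPn/negP => /Fneq0[].
pose k0 := mkix (tagged i).1.1 (one (tag i)) (tagged i).1.1.
have Fk0 : F k0 = 1.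
  rewrite /F /= !eqxx mulr1 -[j]ixstarK -(eqP ij) /k0.
  by case: (i) => l [[S b] T]; exact: gammacoef_bar.
(* Outside the support the leading coefficient would be 0, contradicting [Fk0]. *)
have k0f : k0 \in msupp f.
  rewrite -mcoeff_neq0; apply/eqP => fk0; move/eqP: Fk0.
  by rewrite /F /gammacoef [gcoef _ _ _ _]fk0 mcoeff0 mul0r.
rewrite (bigD1_seq k0) ?fset_uniq //= Fk0 big1 ?addr0 // => k kk0.
by apply/eqP/negPn/negP => /Fneq0[_ /eqP]; rewrite (negPf kk0).
Qed.

End TraceTheory.

Theorem theorem2p2p5
    (A : nu_algebra laurent) (D : table_datum A) (HD : is_tabular D)
    (a : tix D -> int) (tau : A -> laurent)
    (Htau : is_tabular_trace HD a tau) :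
  (* symmetric, bilinear, nondegenerate *)
  [/\ forall x y : A, trform D tau x y = trform D tau y x,
      forall y : A, scalar (fun x : A => trform D tau x y),
      forall x : A, scalar (fun y : A => trform D tau x y)
    & forall x : A, (forall y : A, trform D tau x y = 0) -> x = 0]
  /\ (* (i) *)
  (forall x y z : A,
     trform D tau x (y ** z) = trform D tau (x ** td_star D z) y)
  /\ (* (ii) *)
  (forall i j : tix D,
     (td_C i = td_C j ->
        eqmod_vinv (trform D tau (td_C i) (td_C j)) 1) /\
     (td_C i <> td_C j ->
        eqmod_vinv (trform D tau (td_C i) (td_C j)) 0)).
Proof.
have formC (i j : tix D) : deg_le (trform D tau (td_C i) (td_C j)) 0 /\
    (trform D tau (td_C i) (td_C j))@_0 = (i == j)%:R.
  (* Writing [j] as [ixstar (ixstar j)] on the right matches the second factor [ixstar j] of the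
     product. *)
  rewrite /trform (star_tabular HD) -{3}[j]ixstarK.
  exact: mcoeff0_tau_mul Htau _ _.
have forml y : scalar (fun x : A => trform D tau x y).
  by move=> c x x'; rewrite /trform nu_mul_linearl (tr_linear Htau).
have formS x y : trform D tau x y = trform D tau y x.
  by rewrite /trform (tr_star Htau) (tab_starM HD) (tab_starK HD).
split; [split=> // [x c y y'|x x0]|split=> [x y z|i j]].
- by rewrite ![trform D tau x _]formS forml.
- rewrite -[x](basis_coordK (tab_basis HD)) in x0 *.
  set f := basis_coord _ _ in x0 *.
  (* If [f] is nonzero, pair with the basis element at [i]. As all coordinates have degree at most
     [n], the coefficient of [v^n] in the pairing is that of [f@_i], which is nonzero. *)
  have [->|/ex_max_deg[i [n [fin df]]]] := eqVneq f 0; first exact: linear0.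
  pose t : {scalar A} := HB.pack (fun x => trform D tau x (td_C i))
    (GRing.isLinear.Build laurent A laurent *%R _ (forml (td_C i))).
  have tf : t (lincomb (@td_C A D) f) =
      \sum_(k <- msupp f) f@_k * trform D tau (td_C k) (td_C i).
    by rewrite raddf_sum; apply: eq_bigr => k _; exact: linearZ_LR.
  case/eqP: fin; rewrite -[f@_i]sum_delta.
  transitivity ((t (lincomb (@td_C A D) f))@_n); last by rewrite /= x0 mcoeff0.
  rewrite tf !raddf_sum; apply: eq_bigr => k _; have [dk kE] := formC k i.
  rewrite -[(k == i)%:R](rmorph_nat intr) [LHS]mcoeff_mul_intr.
  by rewrite -{2}[n]addr0 [RHS]mcoeffM_deg_le // kE.
- by rewrite /trform (tab_starM HD) nu_mulA.
- have [dij ijE] := formC i j.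
  split=> [/(tab_C_inj HD) ij|Cij]; apply/eqmod_vinvP => n.
    rewrite le0r mcoeff_laurent1 => /orP[/eqP->|n0].
      by rewrite ijE ij !eqxx.
    by rewrite dij // gt_eqF.
  rewrite mcoeff0 le0r => /orP[/eqP->|/dij //].
  by rewrite ijE; case: eqP Cij => // ->.
Qed.
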